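(* Let $Z=(Z_n)_{n\in\mathbb{N}}$ (with $\mathbb{N}=\{0,1,2,\ldots\}$) be a real-valued stochastic process such that $$\lim_{T\to+\infty}\frac{1}{T^H\ell(T)}\,\mathbb{E}\Big[\sup_{t\in[0,1]}Z_{[tT]}\Big]=\kappa$$ for some $H\in(0,1)$, some $\kappa\in(0,\infty)$ and some function $\ell$ slowly varying at infinity. Assume further that $Z$ is time-reversible in the sense that for every $T\in\mathbb{N}$ the vectors $(Z_{T-k}-Z_T)_{k=0,\ldots,T}$ and $(Z_k)_{k=0,\ldots,T}$ have the same law. Then $$\limsup_{x\to+\infty}\frac{x^{1-H}}{\ell(x)}\,\mathbb{E}\Big[\Big(\sum_{l=0}^{[x]}e^{Z_l}\Big)^{-1}\Big]\le\kappa H$$ and $$\liminf_{x\to+\infty}\frac{x^{1-H}}{\ell(x)}\,\mathbb{E}\Big[\Big(\sum_{l=1}^{[x]}e^{Z_l}\Big)^{-1}\Big]\ge\kappa H.$$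
   Context: $[x]$ denotes the integer part of $x$. Note that the first sum starts at $l=0$ and the second at $l=1$. *)

(* Defs.v *)
From HB Require Import structures.
From mathcomp Require Import all_boot all_order all_algebra.
From mathcomp Require Import all_classical all_reals all_analysis.

Set Implicit Arguments.
Unset Strict Implicit.
Unset Printing Implicit Defensive.

Import Order.TTheory GRing.Theory Num.Theory.
Import numFieldNormedType.Exports.

Local Open Scope classical_set_scope.
Local Open Scope ring_scope.

(* Slow variation at infinity in Karamata's sense; as is standard, L only has
   to be positive and measurable on a neighbourhood of +oo. *)
Definition slowly_varying (R : realType) (L : R -> R) : Prop :=
  exists A : R,
    [/\ measurable_fun `[A, +oo[ L,
        (forall x, A <= x -> 0 < L x) &
        forall c, 0 < c -> L (c * x) / L x @[x --> +oo] --> (1 : R)].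

Definition eq_law d d' (Omega : measurableType d) (S : measurableType d')
    (R : realType) (P : probability Omega R) (X Y : Omega -> S) : Prop :=
  forall A : set S, measurable A -> pushforward P X A = pushforward P Y A.

(* The laws are compared on R^(T+1), i.e. on (T+1)-tuples with the product
   sigma-algebra. *)
Definition time_reversible d (Omega : measurableType d) (R : realType)
    (P : probability Omega R) (Z : nat -> {RV P >-> R}) : Prop :=
  forall T : nat,
    eq_law P (fun w => [tuple Z (T - k)%N w - Z T w | k < T.+1])
             (fun w => [tuple Z k w | k < T.+1]).

(* For t * T >= 0, Num.truncn (t * T) is the integer part [tT]. *)
Definition running_sup d (Omega : measurableType d) (R : realType)
    (P : probability Omega R) (Z : nat -> {RV P >-> R}) (T : R) (w : Omega) : R :=
  sup [set Z (Num.truncn (t * T)) w | t in `[0, 1]%classic].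

(* Main.v *)
Require Import Defs.
From HB Require Import structures.
From mathcomp Require Import all_boot all_order all_algebra.
From mathcomp Require Import all_classical all_reals all_analysis.
From mathcomp Require Import measurable_realfun zify ring lra.

Set Implicit Arguments.
Unset Strict Implicit.
Unset Printing Implicit Defensive.

Import Order.TTheory GRing.Theory Num.Theory.
Import numFieldNormedType.Exports.

Local Open Scope classical_set_scope.
Local Open Scope ring_scope.

(** Write S_n = e^{Z_0} + ... + e^{Z_n}. Applying time reversal to the
    reciprocal of an exponential sum turns it into an increment of log S: the
    variable 1 / S_n has the law of e^{Z_n} / S_n, and 1 / (S_n - e^{Z_0}) has the law of
    e^{Z_n} / S_{n-1} ([reversal_expectation]). The increment
    ln S_n - ln S_{n-1} lies between e^{Z_n} / S_n and e^{Z_n} / S_{n-1}, so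

      E[1 / S_n] <= E[ln S_n] - E[ln S_{n-1}] <= E[1 / (S_n - e^{Z_0})]

    ([mean_inv0_le], [mean_inv1_ge]). Both outer sequences are nonincreasing, so
    a difference quotient of n |-> E[ln S_n] over a block of indices bounds the
    first one at the right end of the block, and the second one at its left end
    ([mean_inv0_sum_le], [mean_inv1_sum_ge]).

    It remains to know E[ln S_n] asymptotically. Since ln S_n differs from the
    running maximum of Z by at most ln (n + 1), the hypothesis gives
    E[ln S_n] ~ kappa g(n) with g(x) = x^H L(x), once ln x = o(g(x)) is known
    ([ln_negligible], [cvg_mean_log]). The latter uses that g is equivalent, up
    to the factor kappa, to a monotone function, the mean running maximum:
    iterating the doubling relation along this function makes it grow at least
    like a power of x ([doubling_growth]).

    Finally, over the block from c x to x (or x to c x) the difference quotient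
    of E[ln S] is equivalent to kappa (1 - c^H) / (1 - c) * g(x) / x, and
    (1 - c^H) / (1 - c) tends to H as c tends to 1 ([difference_quotient_le],
    [difference_quotient_ge]). This is the argument of the monotone density
    theorem. *)

(** * Regular variation *)

Definition regularly_varying (R : realType) (H : R) (g : R -> R) : Prop :=
  (\forall x \near +oo, 0 < g x) /\
  forall c, 0 < c -> g (c * x) / g x @[x --> +oo] --> c `^ H.

Section regular_variation.
Context {R : realType}.
Implicit Types (f g L : R -> R) (H kappa c : R).

Lemma slowly_varying_regular L H :
  slowly_varying L -> regularly_varying H (fun x => x `^ H * L x).
Proof.
move=> [A [_ L0 Lc]]; split.
  near=> x; apply: mulr_gt0.
    by apply: powR_gt0; near: x; exact/nbhs_pinfty_gt/num_real.
  by apply: L0; near: x; exact/nbhs_pinfty_ge/num_real.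
move=> c c0.
have : c `^ H * (L (c * x) / L x) @[x --> +oo] --> c `^ H * 1.
  by apply: cvgMr; exact: Lc.
rewrite mulr1; apply: cvg_trans; apply: near_eq_cvg; near=> x.
have x0 : 0 < x by near: x; exact/nbhs_pinfty_gt/num_real.
have Lx : 0 < L x by apply: L0; near: x; exact/nbhs_pinfty_ge/num_real.
have xH : 0 < x `^ H by rewrite powR_gt0.
rewrite /= powRM ?ltW//; field.
by rewrite !gt_eqF.
Unshelve. all: by end_near. Qed.

Lemma cvgr_scale c : 0 < c -> c * x @[x --> +oo] --> +oo.
Proof. by move=> c0; apply: gt0_cvgMry => //; exact: cvg_id. Qed.

Lemma near_scale c (A : set R) : 0 < c ->
  (\forall x \near +oo, A x) -> \forall x \near +oo, A (c * x).
Proof. by move=> c0; exact: cvgr_scale. Qed.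

Lemma cvg_ratio_scale f g H kappa c : regularly_varying H g ->
  f x / g x @[x --> +oo] --> kappa -> 0 < c ->
  f (c * x) / g x @[x --> +oo] --> kappa * c `^ H.
Proof.
move=> [g0 gc] fg c0.
have h1 : f (c * x) / g (c * x) @[x --> +oo] --> kappa.
  exact: (cvg_comp (fun x => c * x) (fun x => f x / g x) (cvgr_scale c0) fg).
apply: cvg_trans (cvgM h1 (gc _ c0)); apply: near_eq_cvg; near=> x.
have gx : 0 < g x by near: x.
have gcx : 0 < g (c * x) by near: x; exact: (@near_scale _ [set y | 0 < g y]).
by rewrite /=; field; rewrite !gt_eqF.
Unshelve. all: by end_near. Qed.

(** The derivative of x `^ H at 1 is H. *)
Lemma powR_quotient_near1 H (e : R) : 0 < e ->
  \forall h \near 0^', `|H - h^-1 * ((1 + h) `^ H - 1)| < e.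
Proof.
move=> e0.
have [d1 d2] := is_derive1_powR H (@ltr01 R).
rewrite powR1 mulr1 in d2.
have /cvgrPdist_lt/(_ _ e0) := d1; rewrite -/(derive _ _ _) d2.
apply: filterS => h /=.
by rewrite powR1 /GRing.scale /= mulr1 [h + 1]addrC.
Qed.


(** For fixed c the left-hand side is equivalent to kappa (1 - c^H) g(y), and
    (1 - c^H) / (1 - c) is as close to H as desired when c is close to 1. The
    slack e also absorbs the - 1, which leaves room for rounding y and c y to
    integers. *)
Lemma difference_quotient_le f g H kappa e : 0 < H -> 0 < kappa -> 0 < e ->
  regularly_varying H g -> f x / g x @[x --> +oo] --> kappa ->
  exists2 c, 0 < c < 1 & \forall y \near +oo,
    f y - f (c * y) <= (kappa * H + e) * (g y / y) * ((1 - c) * y - 1).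
Proof.
move=> H0 k0 e0 gH fg.
(* Half of e pays for replacing the difference quotient of x `^ H by H, the
   other half for the - 1. *)
have ek : 0 < e / 2 / kappa by rewrite !divr_gt0.
have [r /= r0 rH] := powR_quotient_near1 H ek.
pose t := Num.min (r / 2) (2^-1).
have t0 : 0 < t by rewrite lt_min divr_gt0//= invr_gt0.
have t1 : t < 1 by rewrite gt_min orbC invf_lt1// ltr1n.
have tr : t < r by rewrite gt_min ltr_pdivrMr// mulr2n mulrDr mulr1 ltrDl r0.
pose c := 1 - t; have c01 : 0 < c < 1 by rewrite /c; lra.
exists c => //; have [c0 c1] := andP c01.
have ct : kappa * (1 - c `^ H) < (kappa * H + e / 2) * t.
  have := rH (- t); rewrite /= sub0r opprK gtr0_norm// => /(_ tr).
  rewrite oppr_eq0 gt_eqF// => /(_ isT); rewrite ltr_norml => /andP[+ _].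
  rewrite -/c invrN mulNr -mulrN opprB.
  set q := _ * (1 - _) => hq.
  have -> : 1 - c `^ H = q * t by rewrite /q; field; rewrite gt_eqF.
  rewrite [kappa * (q * t)]mulrA ltr_pM2r//.
  have : kappa * - (e / 2 / kappa) < kappa * (H - q) by rewrite ltr_pM2l.
  rewrite mulrN [kappa * (_ / _)]mulrC divfK ?gt_eqF//; lra.
have lim : f y / g y - f (c * y) / g y @[y --> +oo] --> kappa - kappa * c `^ H.
  by apply: cvgB => //; exact: cvg_ratio_scale.
have lim_lt : kappa - kappa * c `^ H < (kappa * H + e / 2) * t by lra.
near=> y.
have gy : 0 < g y by near: y; exact: gH.1.
have y0 : 0 < y by near: y; exact/nbhs_pinfty_gt/num_real.
have : f y / g y - f (c * y) / g y <= (kappa * H + e / 2) * t.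
  by apply/ltW; near: y; exact: (cvgr_lt _ lim _ lim_lt).
rewrite -mulrBl ler_pdivrMr// => /le_trans; apply.
have -> : (kappa * H + e) * (g y / y) * ((1 - c) * y - 1) =
    (kappa * H + e) * (t - y^-1) * g y.
  by rewrite /c; field; rewrite gt_eqF.
rewrite ler_pM2r// mulrBr.
suff : (kappa * H + e) / y <= e / 2 * t by lra.
rewrite ler_pdivrMr// [leRHS]mulrC -ler_pdivrMr ?mulr_gt0 ?divr_gt0//.
Unshelve. all: by end_near. Qed.

(** Counterpart of [difference_quotient_le] with c slightly above 1, the
    rounding error now having the opposite sign. *)
Lemma difference_quotient_ge f g H kappa e : 0 < H -> 0 < kappa -> 0 < e ->
  regularly_varying H g -> f x / g x @[x --> +oo] --> kappa ->
  exists2 c, 1 < c & \forall y \near +oo,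
    (kappa * H - e) * (g y / y) * ((c - 1) * y + 1) <= f (c * y) - f y.
Proof.
move=> H0 k0 e0 gH fg.
have ek : 0 < e / 2 / kappa by rewrite !divr_gt0.
have [r /= r0 rH] := powR_quotient_near1 H ek.
pose t := r / 2.
have t0 : 0 < t by rewrite divr_gt0.
have tr : t < r by rewrite ltr_pdivrMr// mulr2n mulrDr mulr1 ltrDl r0.
pose c := 1 + t; have c1 : 1 < c by rewrite /c; lra.
exists c => //; have c0 : 0 < c by lra.
have ct : (kappa * H - e / 2) * t < kappa * (c `^ H - 1).
  have := rH t; rewrite /= sub0r normrN gtr0_norm// => /(_ tr).
  rewrite gt_eqF// => /(_ isT); rewrite ltr_norml => /andP[_].
  rewrite -/c; set q := t^-1 * (c `^ H - 1) => hq.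
  have -> : c `^ H - 1 = q * t by rewrite /q; field; rewrite gt_eqF.
  rewrite [kappa * (q * t)]mulrA ltr_pM2r//.
  have : kappa * (H - q) < kappa * (e / 2 / kappa) by rewrite ltr_pM2l.
  rewrite [kappa * (_ / _)]mulrC divfK ?gt_eqF//; lra.
have lim : f (c * y) / g y - f y / g y @[y --> +oo] --> kappa * c `^ H - kappa.
  by apply: cvgB => //; exact: cvg_ratio_scale.
have lim_gt : (kappa * H - e / 2) * t < kappa * c `^ H - kappa by lra.
near=> y.
have gy : 0 < g y by near: y; exact: gH.1.
have y0 : 0 < y by near: y; exact/nbhs_pinfty_gt/num_real.
have : (kappa * H - e / 2) * t <= f (c * y) / g y - f y / g y.
  by apply/ltW; near: y; exact: (cvgr_gt _ lim _ lim_gt).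
rewrite -mulrBl ler_pdivlMr//; apply: le_trans.
have -> : (kappa * H - e) * (g y / y) * ((c - 1) * y + 1) =
    (kappa * H - e) * (t + y^-1) * g y.
  by rewrite /c; field; rewrite gt_eqF.
rewrite ler_pM2r// mulrDr.
suff : (kappa * H - e) / y <= e / 2 * t by lra.
rewrite ler_pdivrMr// [leRHS]mulrC -ler_pdivrMr ?mulr_gt0 ?divr_gt0//.
Unshelve. all: by end_near. Qed.

Lemma powR_cvgy s : 0 < s -> (x : R) `^ s @[x --> +oo] --> +oo.
Proof.
move=> s0; apply/cvgryPge => A; near=> x.
have x0 : 0 <= x by near: x; exact/nbhs_pinfty_ge/num_real.
have Ax : (`|A| `^ s^-1) <= x by near: x; exact/nbhs_pinfty_ge/num_real.
apply: (le_trans (ler_norm A)).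
rewrite -[leLHS]powRr1// -(mulVf (lt0r_neq0 s0)) powRrM.
by apply: ge0_ler_powR; rewrite ?nnegrE ?powR_ge0 ?ltW.
Unshelve. all: by end_near. Qed.

(** From ln u <= u at u = (1 + x) `^ s, and 1 + x <= 2 x. *)
Lemma ln1D_le_powR s (x : R) : 0 < s -> 1 <= x ->
  ln (1 + x) <= s^-1 * 2 `^ s * x `^ s.
Proof.
move=> s0 x1; rewrite -mulrA -powRM//; last lra.
rewrite mulrC ler_pdivlMr// mulrC -ln_powR.
have p0 : 0 < (1 + x) `^ s by apply: powR_gt0; lra.
apply: (@le_trans _ _ ((1 + x) `^ s)).
  move: p0; set p := _ `^ _ => p0; have := @le_ln1Dx _ (p - 1).
  by rewrite [1 + _]addrC subrK => h; apply: (le_trans (h _)); lra.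
by apply: ge0_ler_powR; rewrite ?nnegrE; lra.
Qed.

(** On [X, 2 X] monotonicity gives m x >= m X >= C x `^ rho; each doubling of x
    multiplies m x by at least 2 `^ rho, which is what it does to x `^ rho.
    Monotonicity is what makes the bound uniform over the starting interval. *)
Lemma doubling_growth (m : R -> R) X rho : 0 <= rho -> 1 <= X -> 0 < m X ->
  {homo m : x y / x <= y} ->
  (forall x, X <= x -> 2 `^ rho * m x <= m (2 * x)) ->
  exists2 C, 0 < C & forall x, X <= x -> C * x `^ rho <= m x.
Proof.
move=> rho0 X1 mX mhomo mdbl; have X0 : 0 < X by lra.
pose C := m X / (2 * X) `^ rho.
have p0 : 0 < (2 * X) `^ rho by apply: powR_gt0; lra.
exists C; first exact: divr_gt0.
suff key n : forall x, X <= x -> x <= 2 ^+ n.+1 * X -> C * x `^ rho <= m x.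
  (* x < [x] + 1 <= 2 ^ ([x] + 1) *)
  move=> x Xx; apply: (key (Num.truncn x)) => //.
  have xt := truncnS_gt x; apply/ltW/(lt_le_trans xt).
  rewrite -[leLHS]mulr1; apply: ler_pM => //.
  by rewrite -natrX ler_nat ltnW// ltn_expl.
elim: n => [|n IH] x Xx xn.
  apply: (@le_trans _ _ (m X)); last exact: mhomo.
  rewrite /C mulrAC ler_pdivrMr// ler_pM2l//.
  by apply: ge0_ler_powR; rewrite ?nnegrE//; lra.
have [x2|x2] := leP x (2 * X).
  apply: (@le_trans _ _ (m X)); last exact: mhomo.
  rewrite /C mulrAC ler_pdivrMr// ler_pM2l//.
  by apply: ge0_ler_powR; rewrite ?nnegrE//; lra.
have -> : x = 2 * (x / 2) by field.
apply: le_trans (mdbl _ _); last lra.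
rewrite powRM//; last lra.
rewrite mulrCA; apply: ler_wpM2l; first exact: powR_ge0.
apply: IH; first lra.
by rewrite ler_pdivrMr// mulrAC -exprSr.
Qed.

(** As m (2 x) / m x tends to 2 `^ H, any exponent rho < H is admissible in
    [doubling_growth]; with rho = H / 2, the function m dominates x `^ (H / 2),
    hence ln (1 + x). *)
Lemma ln_negligible (m : R -> R) g H kappa : 0 < H -> 0 < kappa ->
  regularly_varying H g -> {homo m : x y / x <= y} ->
  m x / g x @[x --> +oo] --> kappa -> ln (1 + x) / g x @[x --> +oo] --> (0 : R).
Proof.
move=> H0 k0 gH mhomo mg; pose rho := H / 2.
have rho0 : 0 < rho by rewrite divr_gt0.
have dbl : \forall x \near +oo, 2 `^ rho * m x <= m (2 * x).
  have lim : m (2 * x) / g x - 2 `^ rho * (m x / g x) @[x --> +oo] -->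
      kappa * 2 `^ H - 2 `^ rho * kappa.
    by apply: cvgB; [exact: cvg_ratio_scale|exact: cvgMr].
  have lim_gt : 0 < kappa * 2 `^ H - 2 `^ rho * kappa.
    rewrite mulrC -mulrBl pmulr_lgt0// subr_gt0.
    have rho1 : 1 < 2 `^ rho :> R.
      have := @gt0_ltr_powR R rho rho0 1 2.
      by rewrite !nnegrE powR1; apply; lra.
    have -> : H = rho + rho by rewrite /rho; field.
    by rewrite powRD ?pnatr_eq0 ?implybT// ltr_pMl// (lt_trans ltr01).
  near=> x.
  have gx : 0 < g x by near: x; exact: gH.1.
  have : 0 < m (2 * x) / g x - 2 `^ rho * (m x / g x).
    by near: x; exact: (cvgr_gt _ lim _ lim_gt).
  by rewrite mulrA -mulrBl pmulr_lgt0 ?invr_gt0// subr_gt0 => /ltW.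
have mpos : \forall x \near +oo, 0 < m x.
  near=> x.
  have gx : 0 < g x by near: x; exact: gH.1.
  have : 0 < m x / g x by near: x; exact: (cvgr_gt _ mg _ k0).
  by rewrite pmulr_lgt0 ?invr_gt0.
have [M [_ Mx]] : \forall x \near +oo, 2 `^ rho * m x <= m (2 * x) /\ 0 < m x.
  by near=> x; split; near: x.
pose X := Num.max M 0 + 1.
have X1 : 1 <= X by rewrite /X lerDr le_max lexx orbT.
have MX : M < X by rewrite /X ltr_pwDr// le_max lexx.
have [C C0 Cm] : exists2 C, 0 < C & forall x, X <= x -> C * x `^ rho <= m x.
  apply: doubling_growth => //; [exact: ltW|exact: (Mx _ MX).2|].
  by move=> x Xx; apply: (Mx x _).1; exact: lt_le_trans Xx.
pose s := rho / 2; have s0 : 0 < s by rewrite divr_gt0.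
pose K := s^-1 * 2 `^ s / C.
have lim : K * (x `^ s)^-1 * (m x / g x) @[x --> +oo] --> K * 0 * kappa.
  apply: cvgM => //; apply: cvgMr.
  apply/(@gtr0_cvgV0 _ _ _ _ (fun x : R => x `^ s)); last exact: powR_cvgy.
  by near=> x; apply: powR_gt0; near: x; exact/nbhs_pinfty_gt/num_real.
rewrite mulr0 mul0r in lim.
apply: (squeeze_cvgr _ (cvg_cst _) lim); near=> x.
have gx : 0 < g x by near: x; exact: gH.1.
have xX : X <= x by near: x; exact/nbhs_pinfty_ge/num_real.
have x1 : 1 <= x by exact: le_trans xX.
apply/andP; split.
  by apply: divr_ge0; [apply: ln_ge0; lra|exact: ltW].
rewrite mulrA ler_pM2r ?invr_gt0//.
apply: (le_trans (ln1D_le_powR s0 x1)).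
have xs0 : 0 < x `^ s by apply: powR_gt0; lra.
have xrho : x `^ rho = x `^ s * x `^ s.
  rewrite -powRD; last by rewrite (gt_eqF (lt_le_trans ltr01 x1)) implybT.
  by congr (_ `^ _); rewrite /s; field.
apply: (@le_trans _ _ (K * (x `^ s)^-1 * (C * x `^ rho))).
  rewrite xrho /K le_eqVlt; apply/orP; left; apply/eqP.
  by field; rewrite !gt_eqF.
apply: ler_wpM2l; last exact: Cm.
by rewrite /K !(mulr_ge0, invr_ge0, powR_ge0)// ltW.
Unshelve. all: by end_near. Qed.

End regular_variation.

(** * Expectations of almost surely nonnegative variables *)

Section expectation_ae.
Context d (Omega : measurableType d) (R : realType) (P : probability Omega R).
Implicit Types X Y : Omega -> R.

Lemma expectation_ae_eq X Y :
  measurable_fun setT X -> measurable_fun setT Y ->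
  (\forall w \ae P, X w = Y w) -> ('E_P[X] = 'E_P[Y])%E.
Proof.
move=> mX mY XY; rewrite unlock; apply: ae_eq_integral => //.
- exact/measurable_EFinP.
- exact/measurable_EFinP.
- by apply: filterS XY => w + _ /= => ->.
Qed.

Lemma expectation_le_ae X Y :
  measurable_fun setT X -> measurable_fun setT Y ->
  (\forall w \ae P, 0 <= X w <= Y w) -> ('E_P[X] <= 'E_P[Y])%E.
Proof.
move=> mX mY XY.
have mX0 : measurable_fun setT (X \max cst 0) by exact: measurable_maxr.
have mY0 : measurable_fun setT (Y \max cst 0) by exact: measurable_maxr.
rewrite (expectation_ae_eq mX mX0); last first.
  by apply: filterS XY => w /andP[X0 _] /=; rewrite max_l.
rewrite (expectation_ae_eq mY mY0); last first.
  by apply: filterS XY => w /andP[X0 /(le_trans X0) Y0] /=; rewrite max_l.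
apply: expectation_le => // [w|w|]; rewrite ?le_max ?lexx ?orbT//.
apply: filterS XY => w /andP[_ XYw] /=.
by rewrite ge_max !le_max XYw lexx orbT.
Qed.

Lemma Lfun1_ae_ge0 X : measurable_fun setT X -> (\forall w \ae P, 0 <= X w) ->
  ('E_P[X] < +oo)%E -> X \in Lfun P 1.
Proof.
move=> mX X0 EX; apply/Lfun1_integrable/integrableP; split.
  exact/measurable_EFinP.
have mN : measurable_fun setT (fun w => `|X w|) by exact: measurableT_comp.
rewrite (_ : (\int[P]_x _)%E = 'E_P[fun w => `|X w|%R]%E); last first.
  by rewrite unlock.
rewrite (expectation_ae_eq mN mX)//.
by apply: filterS X0 => w X0; rewrite ger0_norm.
Qed.

Lemma eq_law_expectation d' (S : measurableType d') (U V : Omega -> S)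
    (f : S -> R) :
  measurable_fun setT U -> measurable_fun setT V -> measurable_fun setT f ->
  (forall s, 0 <= f s) -> eq_law P U V ->
  'E_P[fun w => f (U w)]%E = 'E_P[fun w => f (V w)]%E.
Proof.
move=> mU mV mf f0 UV; rewrite unlock.
have mf' : measurable_fun setT (EFin \o f) by exact/measurable_EFinP.
have f0' : {in setT, forall s, (0 <= (EFin \o f) s)%E}.
  by move=> s _; rewrite lee_fin.
have := ge0_integral_pushforward mU P measurableT mf' f0'.
rewrite preimage_setT => <-.
have := ge0_integral_pushforward mV P measurableT mf' f0'.
rewrite preimage_setT => <-.
by apply: eq_measure_integral => A mA _; exact: UV.
Qed.

End expectation_ae.

(** * Exponential sums of a process *)

(** Both bounds are ln (1 + u) <= u, at u = e / s and at u = - e / (s + e). *)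
Lemma ln_increment_bounds (R : realType) (s e : R) : 0 < s -> 0 < e ->
  e / (s + e) <= ln (s + e) - ln s <= e / s.
Proof.
move=> s0 e0; have se0 : 0 < s + e by lra.
rewrite -ln_div ?posrE//; apply/andP; split.
  rewrite -lerN2 -lnV ?posrE ?divr_gt0// invf_div.
  have -> : s / (s + e) = 1 + - (e / (s + e)) by field; rewrite gt_eqF.
  by apply: le_ln1Dx; rewrite ltrN2 ltr_pdivrMr//; lra.
have -> : (s + e) / s = 1 + e / s by field; rewrite gt_eqF.
by apply: le_ln1Dx; apply: (@lt_trans _ _ 0); rewrite ?divr_gt0//; lra.
Qed.

(** On nonnegative reals the inverse is the power of exponent -1, also at 0. *)
Lemma measurable_inv_ge0 d (T : measurableType d) (R : realType) (f : T -> R) :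
  (forall x, 0 <= f x) -> measurable_fun setT f ->
  measurable_fun setT (fun x => (f x)^-1).
Proof.
move=> f0 mf; under eq_fun do rewrite -powR_inv1//.
exact: measurableT_comp (measurable_powR _) mf.
Qed.

Section exponential_sums.
Context d (Omega : measurableType d) (R : realType) (P : probability Omega R).
Context (Z : nat -> {RV P >-> R}).

Definition exp_sum (m n : nat) (w : Omega) : R :=
  \sum_(m <= l < n) expR (Z l w).

Definition running_max (n : nat) (w : Omega) : R :=
  \big[Order.max/Z 0%N w]_(0 <= l < n.+1) Z l w.

Lemma exp_sum_ge0 m n w : 0 <= exp_sum m n w.
Proof. by apply: sumr_ge0 => l _; exact: expR_ge0. Qed.

Lemma measurable_exp_sum m n : measurable_fun setT (exp_sum m n).
Proof.
by apply: measurable_sum => l; exact: measurableT_comp.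
Qed.

Lemma measurable_inv_exp_sum m n :
  measurable_fun setT (fun w => (exp_sum m n w)^-1).
Proof.
exact: measurable_inv_ge0 (exp_sum_ge0 m n) (measurable_exp_sum m n).
Qed.

Lemma measurable_ln_exp_sum m n :
  measurable_fun setT (fun w => ln (exp_sum m n w)).
Proof. exact: measurableT_comp (measurable_exp_sum m n). Qed.

Lemma measurable_running_max n : measurable_fun setT (running_max n).
Proof.
rewrite /running_max; elim: (index_iota 0 n.+1) => [|l s IH].
  by under eq_fun do rewrite big_nil; exact: measurable_funPT.
by under eq_fun do rewrite big_cons; exact: measurable_maxr.
Qed.

Lemma exp_sum_recr m n w : (m <= n)%N ->
  exp_sum m n.+1 w = exp_sum m n w + expR (Z n w).
Proof. by move=> mn; rewrite /exp_sum big_nat_recr. Qed.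

Lemma exp_sum_gt0 m n w : (m <= n)%N -> 0 < exp_sum m n.+1 w.
Proof.
by move=> mn; rewrite exp_sum_recr// ltr_wpDl ?exp_sum_ge0 ?expR_gt0.
Qed.

Lemma le_exp_sum m n n' w : (n <= n')%N -> exp_sum m n w <= exp_sum m n' w.
Proof.
move=> nn'; rewrite /exp_sum.
have [mn|/ltnW mn] := leqP m n; last first.
  by rewrite [leLHS]big_geq//; exact: exp_sum_ge0.
rewrite [leRHS](big_cat_nat mn nn') /= lerDl.
by apply: sumr_ge0 => l _; exact: expR_ge0.
Qed.

Lemma running_max_ge k n w : (k <= n)%N -> Z k w <= running_max n w.
Proof.
move=> kn; apply: (le_bigmax_seq _ k xpredT (fun l => Z l w)) => //.
by rewrite mem_index_iota.
Qed.

Lemma running_max_le n w (x : R) :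
  (forall k, (k <= n)%N -> Z k w <= x) -> running_max n w <= x.
Proof.
move=> Zx; rewrite /running_max big_nat_cond.
apply: bigmax_le => [|k /andP[/andP[_]]]; first exact: Zx.
by rewrite ltnS => kn _; exact: Zx.
Qed.

(** The index [t T] runs through all of 0, ..., [T] as t runs through [0, 1]:
    it takes the value k at t = k / T. For T < 1, in particular for negative T,
    only the index 0 occurs. *)
Lemma running_supE (T : R) w :
  running_sup Z T w = running_max (Num.truncn T) w.
Proof.
have le_trunc (t : R) : 0 <= t <= 1 -> (Num.truncn (t * T) <= Num.truncn T)%N.
  move=> /andP[t0 t1]; have [T0|T0] := leP 0 T.
    by apply: le_truncn; rewrite ler_piMl.
  have -> : Num.truncn (t * T) = 0%N; last by [].
  apply/eqP; rewrite -leqn0 truncn_le_nat.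
  by apply: (@le_lt_trans _ _ 0); rewrite ?ltr01// mulr_ge0_le0// ltW.
have ubd : ubound [set Z (Num.truncn (t * T)) w | t in `[0, 1]]
    (running_max (Num.truncn T) w).
  move=> y [t /=]; rewrite in_itv/= => t01 <-.
  by apply: running_max_ge; exact: le_trunc.
apply/eqP; rewrite eq_le; apply/andP; split.
  rewrite /running_sup; apply: ge_sup ubd.
  exists (Z (Num.truncn (0 * T)) w), 0 => //=.
  by rewrite in_itv/= lexx ler01.
apply: running_max_le => k kT; apply: ub_le_sup; first by eexists; exact: ubd.
have [->|k0] := eqVneq k 0%N.
  exists 0; first by rewrite /= in_itv/= lexx ler01.
  by rewrite mul0r truncn0.
have T1 : 1 <= T by rewrite -truncn_gt0 (leq_trans _ kT)// lt0n.
have T0 : 0 < T by exact: lt_le_trans T1.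
exists (k%:R / T); last by rewrite divfK ?gt_eqF// natrK.
rewrite /= in_itv/= ler_pdivrMr// mul1r -truncn_ge_nat ?(ltW T0)// kT andbT.
by rewrite divr_ge0 ?ler0n// ltW.
Qed.

(** The exponential sum has n + 1 terms, each at most the exponential of the
    maximum, and is at least any one of them. *)
Lemma ln_exp_sum_bounds n w :
  running_max n w <= ln (exp_sum 0 n.+1 w) <= running_max n w + ln n.+1%:R.
Proof.
have S0 : 0 < exp_sum 0 n.+1 w by exact: exp_sum_gt0.
apply/andP; split.
  apply: running_max_le => k kn.
  rewrite -[leLHS]expRK ler_ln ?posrE ?expR_gt0//.
  apply: le_trans (le_exp_sum 0 w (kn : (k.+1 <= n.+1)%N)).
  by rewrite exp_sum_recr// lerDr exp_sum_ge0.
rewrite -[X in X + _]expRK -lnM ?posrE ?expR_gt0//.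
rewrite ler_ln ?posrE ?mulr_gt0 ?expR_gt0//.
rewrite /exp_sum -[n.+1 in leRHS]subn0 mulr_natr -sumr_const_nat.
apply: ler_sum_nat => k /andP[_ kn].
by rewrite ler_expR; exact: running_max_ge.
Qed.

Lemma exp_sum_reverse m n w :
  \sum_(m <= l < n.+1) expR (Z (n - l)%N w - Z n w) =
  expR (- Z n w) * exp_sum 0 (n.+1 - m) w.
Proof.
rewrite /exp_sum mulr_sumr big_nat_rev /= -{1}[m]add0n big_addn.
apply: eq_big_nat => l /andP[_ lm].
rewrite -expRD addrC; congr (expR (_ + Z _ w)); lia.
Qed.

(** Replacing each Z_l by Z_{n-l} - Z_n does not change the law of the sum, and
    turns it into e^{- Z_n} times the sum of the first n + 1 - m exponentials of
    Z. The two cases of interest are m = 0 and m = 1. *)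
Lemma reversal_expectation m n : time_reversible Z ->
  'E_P[fun w => ((exp_sum m n.+1 w)^-1)%R]%E =
  'E_P[fun w => (expR (Z n w) / exp_sum 0 (n.+1 - m) w)%R]%E.
Proof.
move=> /(_ n) rev.
pose f (t : n.+1.-tuple R) : R :=
  (\sum_(l < n.+1 | (m <= l)%N) expR (tnth t l))^-1.
have mf : measurable_fun setT f.
  apply: measurable_inv_ge0 => [t|].
    by apply: sumr_ge0 => l _; exact: expR_ge0.
  pose r := [seq l : 'I_n.+1 <- index_enum 'I_n.+1 | (m <= l)%N].
  rewrite (_ : (fun _ => _) =
    fun t : n.+1.-tuple R => \sum_(l <- r) expR (tnth t l)).
    apply: measurable_sum => l; apply: measurableT_comp => //.
    exact: measurable_tnth.
  by apply/funext => t; rewrite big_filter.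
have f0 t : 0 <= f t.
  by rewrite invr_ge0; apply: sumr_ge0 => l _; exact: expR_ge0.
have mU : measurable_fun setT
    (fun w => [tuple Z (n - k)%N w - Z n w | k < n.+1]).
  apply/measurable_fun_tnthP => i.
  rewrite (_ : _ \o _ = (Z (n - i)%N \- Z n)); first exact: measurable_funB.
  by apply/funext => w /=; rewrite tnth_mktuple.
have mV : measurable_fun setT (fun w => [tuple Z k w | k < n.+1]).
  apply/measurable_fun_tnthP => i.
  rewrite (_ : _ \o _ = Z i)//.
  by apply/funext => w /=; rewrite tnth_mktuple.
have := eq_law_expectation mU mV mf f0 rev.
rewrite (_ : (fun w => f [tuple Z k w | k < n.+1]) =
    fun w => (exp_sum m n.+1 w)^-1); last first.
  apply/funext => w; rewrite /f /exp_sum big_geq_mkord; congr (_^-1).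
  by apply: eq_bigr => l _; rewrite tnth_mktuple.
move=> <-; congr ('E_P[ _ ])%E; apply/funext => w.
rewrite -[RHS]invrK invf_div mulrC -expRN -exp_sum_reverse big_geq_mkord /f.
by congr (_^-1); apply: eq_bigr => l _; rewrite tnth_mktuple.
Qed.

(** Reversal over a horizon of length zero: Z_0 has the law of Z_0 - Z_0 = 0. *)
Lemma ae_Z0_eq0 : time_reversible Z -> \forall w \ae P, Z 0%N w = 0.
Proof.
move=> /(_ 0%N) rev.
pose A : set (1.-tuple R) := [set t | tnth t ord0 = 0].
have mA : measurable A.
  have := measurable_tnth (ord0 : 'I_1) measurableT (measurable_set1 (0 : R)).
  by rewrite setTI.
have := rev A mA; rewrite /pushforward.
have -> : (fun w => [tuple Z (0 - k)%N w - Z 0%N w | k < 1]) @^-1` A = setT.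
  apply/seteqP; split => // w _ /=.
  by rewrite /A /= tnth_mktuple subnn subrr.
have -> : (fun w => [tuple Z k w | k < 1]) @^-1` A = [set w | Z 0%N w = 0].
  by apply/seteqP; split => w /=; rewrite /A /= tnth_mktuple.
rewrite probability_setT => Z01.
have mB : measurable [set w | Z 0%N w = 0].
  exact: measurable_funPTI (measurable_set1 (0 : R)).
apply/negligibleP; first exact: measurableC.
by apply: etrans (probability_setC P mB) _; rewrite -Z01 subee.
Qed.

(** * Mean logarithm of the exponential sums *)

Context (Z_rev : time_reversible Z)
  (max_lty : forall n, ('E_P[running_max n] < +oo)%E).

Lemma ae_running_max_ge0 n : \forall w \ae P, 0 <= running_max n w.
Proof.
apply: filterS (ae_Z0_eq0 Z_rev) => w <-; exact: running_max_ge.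
Qed.

Lemma Lfun_running_max n : running_max n \in Lfun P 1.
Proof.
apply: Lfun1_ae_ge0 => //; first exact: measurable_running_max.
exact: ae_running_max_ge0.
Qed.

Definition mean_max (n : nat) : R := fine 'E_P[running_max n].

Lemma mean_maxE n : (mean_max n)%:E = 'E_P[running_max n]%E.
Proof. by rewrite fineK// expectation_fin_num// Lfun_running_max. Qed.

Lemma le_mean_max n n' : (n <= n')%N -> mean_max n <= mean_max n'.
Proof.
move=> nn'; rewrite -lee_fin !mean_maxE; apply: expectation_le_ae.
- exact: measurable_running_max.
- exact: measurable_running_max.
apply: filterS (ae_running_max_ge0 n) => w ->.
by apply: running_max_le => k kn; apply: running_max_ge; exact: leq_trans nn'.
Qed.

Lemma expectation_max_addr n (c : R) :
  'E_P[fun w => (running_max n w + c)%R]%E = (mean_max n + c)%:E.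
Proof.
rewrite EFinD mean_maxE -(expectation_cst P c) -expectationD//.
  exact: Lfun_running_max.
exact: Lfun_cst.
Qed.

Lemma ae_ln_exp_sum_ge0 n : \forall w \ae P, 0 <= ln (exp_sum 0 n.+1 w).
Proof.
apply: filterS (ae_running_max_ge0 n) => w /le_trans; apply.
by case/andP: (ln_exp_sum_bounds n w).
Qed.

Lemma expectation_ln_exp_sum_le n :
  ('E_P[fun w => ln (exp_sum 0 n.+1 w)] <= (mean_max n + ln n.+1%:R)%:E)%E.
Proof.
rewrite -expectation_max_addr; apply: expectation_le_ae.
- exact: measurable_ln_exp_sum.
- by apply: measurable_funD => //; exact: measurable_running_max.
- apply: filterS (ae_ln_exp_sum_ge0 n) => w ->.
  by case/andP: (ln_exp_sum_bounds n w).
Qed.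

Lemma Lfun_ln_exp_sum n : (fun w => ln (exp_sum 0 n.+1 w)) \in Lfun P 1.
Proof.
apply: Lfun1_ae_ge0; first exact: measurable_ln_exp_sum.
  exact: ae_ln_exp_sum_ge0.
exact: le_lt_trans (expectation_ln_exp_sum_le n) (ltry _).
Qed.

Definition mean_log (n : nat) : R :=
  fine 'E_P[fun w => ln (exp_sum 0 n.+1 w)].

Lemma mean_logE n :
  (mean_log n)%:E = 'E_P[fun w => ln (exp_sum 0 n.+1 w)]%E.
Proof. by rewrite fineK// expectation_fin_num// Lfun_ln_exp_sum. Qed.

Lemma mean_log_bounds n :
  mean_max n <= mean_log n <= mean_max n + ln n.+1%:R.
Proof.
rewrite -!lee_fin mean_logE expectation_ln_exp_sum_le andbT mean_maxE.
apply: expectation_le_ae; first exact: measurable_running_max.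
  exact: measurable_ln_exp_sum.
apply: filterS (ae_running_max_ge0 n) => w ->.
by case/andP: (ln_exp_sum_bounds n w).
Qed.

Lemma mean_log_increment n : ((mean_log n.+1 - mean_log n)%:E =
  'E_P[fun w => (ln (exp_sum 0 n.+2 w) - ln (exp_sum 0 n.+1 w))%R])%E.
Proof.
by rewrite EFinB !mean_logE -expectationB ?Lfun_ln_exp_sum.
Qed.

(** Kept in the extended reals: for m > 0 no a priori lower bound on the
    exponential sum makes this expectation finite. *)
Definition mean_inv (m n : nat) : \bar R :=
  'E_P[fun w => ((exp_sum m n.+1 w)^-1)%R]%E.

Lemma mean_inv_ge0 m n : (0 <= mean_inv m n)%E.
Proof. by apply: expectation_ge0 => w; rewrite invr_ge0 exp_sum_ge0. Qed.

Lemma ge_mean_inv m n n' : (m <= n <= n')%N ->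
  (mean_inv m n' <= mean_inv m n)%E.
Proof.
move=> /andP[mn nn']; apply: expectation_le.
- exact: measurable_inv_exp_sum.
- exact: measurable_inv_exp_sum.
- by move=> w; rewrite invr_ge0 exp_sum_ge0.
- by move=> w; rewrite invr_ge0 exp_sum_ge0.
apply: aeW => w; rewrite lef_pV2 ?posrE ?exp_sum_gt0//; last first.
  exact: leq_trans nn'.
by apply: le_exp_sum; rewrite ltnS.
Qed.

Lemma measurable_expR_div_exp_sum n m k :
  measurable_fun setT (fun w => expR (Z n w) / exp_sum m k w).
Proof.
apply: measurable_funM; first exact: measurableT_comp.
exact: measurable_inv_exp_sum.
Qed.

Lemma measurable_ln_increment n : measurable_fun setT
  (fun w => ln (exp_sum 0 n.+2 w) - ln (exp_sum 0 n.+1 w)).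
Proof. by apply: measurable_funB; exact: measurable_ln_exp_sum. Qed.

Lemma exp_sum_increment_bounds n w :
  expR (Z n.+1 w) / exp_sum 0 n.+2 w <=
    ln (exp_sum 0 n.+2 w) - ln (exp_sum 0 n.+1 w) <=
    expR (Z n.+1 w) / exp_sum 0 n.+1 w.
Proof.
rewrite (exp_sum_recr w (leq0n n.+1)).
by apply: ln_increment_bounds; rewrite ?expR_gt0 ?exp_sum_gt0.
Qed.

Lemma expR_div_exp_sum_ge0 n m k w : 0 <= expR (Z n w) / exp_sum m k w.
Proof. by rewrite divr_ge0 ?expR_ge0 ?exp_sum_ge0. Qed.

Lemma ln_increment_ge0 n w :
  0 <= ln (exp_sum 0 n.+2 w) - ln (exp_sum 0 n.+1 w).
Proof.
case/andP: (exp_sum_increment_bounds n w) => + _.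
by apply: le_trans; exact: expR_div_exp_sum_ge0.
Qed.

Lemma mean_inv0_le n : (mean_inv 0 n.+1 <= (mean_log n.+1 - mean_log n)%:E)%E.
Proof.
rewrite /mean_inv reversal_expectation// mean_log_increment subn0.
apply: expectation_le.
- exact: measurable_expR_div_exp_sum.
- exact: measurable_ln_increment.
- exact: expR_div_exp_sum_ge0.
- exact: ln_increment_ge0.
by apply: aeW => w; case/andP: (exp_sum_increment_bounds n w).
Qed.

Lemma mean_inv1_ge n : ((mean_log n.+1 - mean_log n)%:E <= mean_inv 1 n.+1)%E.
Proof.
rewrite /mean_inv reversal_expectation// mean_log_increment subn1.
apply: expectation_le.
- exact: measurable_ln_increment.
- exact: measurable_expR_div_exp_sum.
- exact: ln_increment_ge0.
- exact: expR_div_exp_sum_ge0.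
by apply: aeW => w; case/andP: (exp_sum_increment_bounds n w).
Qed.

(** The block sum of the increments of [mean_log] bounds that of the means of
    the inverses, whose smallest term is the last one. *)
Lemma mean_inv0_sum_le n n' : (n <= n')%N ->
  ((n' - n)%:R%:E * mean_inv 0 n' <= (mean_log n' - mean_log n)%:E)%E.
Proof.
move=> /subnKC <-; rewrite addKn; elim: (n' - n)%N => [|k IH].
  by rewrite addn0 mul0e subrr.
rewrite addnS -natr1 (EFinD _%:R 1) ge0_muleDl ?lee_fin// mul1e.
rewrite (_ : mean_log (n + k).+1 - mean_log n =
  (mean_log (n + k) - mean_log n) + (mean_log (n + k).+1 - mean_log (n + k)));
  last by ring.
rewrite EFinD; apply: leeD; last exact: mean_inv0_le.
apply: le_trans IH; apply: lee_wpmul2l; first by rewrite lee_fin.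
by apply: ge_mean_inv; rewrite /= leqnSn.
Qed.

(** Here the largest of the means of the inverses is the first one; it may be
    infinite. The sum from 1 to n is empty for n = 0, whence 0 < n. *)
Lemma mean_inv1_sum_ge n n' : (0 < n <= n')%N ->
  ((mean_log n' - mean_log n)%:E <= (n' - n)%:R%:E * mean_inv 1 n)%E.
Proof.
move=> /andP[n0 /subnKC <-]; rewrite addKn; elim: (n' - n)%N => [|k IH].
  by rewrite addn0 mul0e subrr.
rewrite addnS -natr1 (EFinD _%:R 1) ge0_muleDl ?lee_fin// mul1e.
rewrite (_ : mean_log (n + k).+1 - mean_log n =
  (mean_log (n + k) - mean_log n) + (mean_log (n + k).+1 - mean_log (n + k)));
  last by ring.
rewrite EFinD; apply: leeD => //; apply: le_trans (mean_inv1_ge _) _.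
by apply: ge_mean_inv; rewrite n0/= leqW// leq_addr.
Qed.

End exponential_sums.

(** * Asymptotics *)

Lemma limf_esup_le (R : realType) (f : R -> \bar R) (c : R) :
  (forall e, 0 < e -> \forall x \near +oo, (f x <= (c + e)%:E)%E) ->
  (limf_esup f +oo%R <= c%:E)%E.
Proof.
move=> fc; apply/lee_addgt0Pr => e e0; have nV := fc _ e0.
pose V := [set x | (f x <= (c + e)%:E)%E].
apply: (@le_trans _ _ (ereal_sup (f @` V))).
  by apply: ereal_inf_lbound; exists V.
by apply: ge_ereal_sup => _ [x Vx <-].
Qed.

Lemma limf_einf_ge (R : realType) (f : R -> \bar R) (c : R) :
  (forall e, 0 < e -> \forall x \near +oo, ((c - e)%:E <= f x)%E) ->
  (c%:E <= limf_einf f +oo%R)%E.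
Proof.
move=> fc; rewrite /limf_einf leeNr -EFinN; apply: limf_esup_le => e e0.
by apply: filterS (fc e e0) => x fx; rewrite leeNl -EFinN opprD opprK.
Qed.

Section mean_asymptotics.
Context d (Omega : measurableType d) (R : realType) (P : probability Omega R).
Context (Z : nat -> {RV P >-> R}) (g : R -> R) (H kappa : R).
Context (H_gt0 : 0 < H) (kappa_gt0 : 0 < kappa) (gH : regularly_varying H g).
Context (cvg_sup :
  (((g T)^-1)%:E * 'E_P[running_sup Z T])%E @[T --> +oo] --> kappa%:E).
Context (Z_rev : time_reversible Z).

Let running_supE' T : running_sup Z T = running_max Z (Num.truncn T).
Proof. by apply/funext => w; exact: running_supE. Qed.

(** Convergence to a finite limit forces the mean running maximum to be finite
    at arbitrarily large times, and it is monotone in time because Z_0 = 0 makes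
    all the maxima almost surely nonnegative. *)
Lemma expectation_max_lty n : ('E_P[running_max Z n] < +oo)%E.
Proof.
have /fine_cvgP[fin _] := cvg_sup.
have [M [_ MT]] : \forall T \near +oo, [/\ n%:R <= T, 0 < g T &
    (((g T)^-1)%:E * 'E_P[running_sup Z T])%E \is a fin_num].
  near=> T; split.
  - by near: T; exact/nbhs_pinfty_ge/num_real.
  - by near: T; exact: gH.1.
  - by near: T.
have [nT gT] := MT (M + 1) (ltr_pwDr ltr01 (lexx _)).
rewrite running_supE'; set T := M + 1 in nT gT *.
move=> finT; have nT' : (n <= Num.truncn T)%N.
  by rewrite truncn_ge_nat// (le_trans _ nT).
apply: (@le_lt_trans _ _ 'E_P[running_max Z (Num.truncn T)]%E).
  apply: expectation_le_ae; try exact: measurable_running_max.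
  apply: filterS (ae_Z0_eq0 Z_rev) => w Z0.
  rewrite -{1}Z0 running_max_ge//=; apply: running_max_le => k kn.
  by apply: running_max_ge; exact: leq_trans nT'.
rewrite ltey; apply/eqP => EMy; move: finT.
by rewrite EMy gt0_muley// lte_fin invr_gt0.
Unshelve. all: by end_near. Qed.

Lemma cvg_mean_max :
  mean_max Z (Num.truncn T) / g T @[T --> +oo] --> kappa.
Proof.
have /fine_cvgP[_] := cvg_sup; apply: cvg_trans; apply: near_eq_cvg.
near=> T; rewrite /= running_supE' -(mean_maxE Z_rev expectation_max_lty).
by rewrite -EFinM /= mulrC.
Unshelve. all: by end_near. Qed.

(** The mean of ln S_n exceeds that of the running maximum by at most
    ln (n + 1), which is negligible with respect to g. *)
Lemma cvg_mean_log :
  mean_log Z (Num.truncn T) / g T @[T --> +oo] --> kappa.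
Proof.
have ln0 : ln (1 + T) / g T @[T --> +oo] --> (0 : R).
  apply: (ln_negligible H_gt0 kappa_gt0 gH _ cvg_mean_max) => x y xy.
  by apply: (le_mean_max Z_rev expectation_max_lty); exact: le_truncn.
have lim : mean_max Z (Num.truncn T) / g T + ln (1 + T) / g T @[T --> +oo]
    --> kappa.
  by rewrite -[X in _ --> X]addr0; exact: cvgD cvg_mean_max ln0.
apply: squeeze_cvgr cvg_mean_max lim; near=> T.
have gT : 0 < g T by near: T; exact: gH.1.
have T0 : 0 <= T by near: T; exact/nbhs_pinfty_ge/num_real.
have /andP[lo hi] := mean_log_bounds Z_rev expectation_max_lty (Num.truncn T).
rewrite /= -mulrDl !ler_pM2r ?invr_gt0// lo/=; apply: (le_trans hi).
rewrite lerD2l ler_ln ?posrE ?ltr0n//; last lra.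
by rewrite -natr1 addrC lerD2l truncn_le.
Unshelve. all: by end_near. Qed.

(** The block of integers from [c x] to [x], with c < 1, has at least
    (1 - c) x - 1 steps, and x is its right end. *)
Lemma mean_inv0_eventually_le (e : R) : 0 < e ->
  \forall x \near +oo,
    ((x / g x)%:E * mean_inv Z 0 (Num.truncn x) <= (kappa * H + e)%:E)%E.
Proof.
move=> e0.
have [c /andP[c0 c1] dq] :=
  difference_quotient_le H_gt0 kappa_gt0 e0 gH cvg_mean_log.
near=> x.
have gx : 0 < g x by near: x; exact: gH.1.
have x0 : 0 < x by near: x; exact/nbhs_pinfty_gt/num_real.
have D0 : 0 < (1 - c) * x - 1.
  rewrite subr_gt0 mulrC -ltr_pdivrMr; last lra.
  by near: x; exact/nbhs_pinfty_gt/num_real.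
have cx : c * x <= x by rewrite ler_piMl// ltW.
have cn := le_truncn cx.
have dn : (1 - c) * x - 1 <= (Num.truncn x - Num.truncn (c * x))%:R.
  have := truncnS_gt x; have := truncn_le (c * x); rewrite natrB// -natr1.
  rewrite mulr_ge0 ?(ltW c0) ?(ltW x0)//; lra.
have -> : x / g x = (g x / x)^-1 by rewrite invf_div.
rewrite lee_pdivrMl ?divr_gt0//.
rewrite -(@lee_pmul2l _ ((1 - c) * x - 1)%:E) ?lte_fin//.
apply: (@le_trans _ _ ((Num.truncn x - Num.truncn (c * x))%:R%:E *
    mean_inv Z 0 (Num.truncn x))%E).
  by apply: lee_wpmul2r; rewrite ?mean_inv_ge0// lee_fin.
apply: le_trans (mean_inv0_sum_le Z_rev expectation_max_lty cn) _.
rewrite -!EFinM lee_fin.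
rewrite [leRHS](_ : _ = (kappa * H + e) * (g x / x) * ((1 - c) * x - 1)).
  by near: x.
by ring.
Unshelve. all: by end_near. Qed.

(** The block of integers from [x] to [c x], with c > 1, has at most
    (c - 1) x + 1 steps, and x is its left end. *)
Lemma mean_inv1_eventually_ge (e : R) : 0 < e ->
  \forall x \near +oo,
    ((kappa * H - e)%:E <= (x / g x)%:E * mean_inv Z 1 (Num.truncn x))%E.
Proof.
move=> e0.
have [c c1 dq] := difference_quotient_ge H_gt0 kappa_gt0 e0 gH cvg_mean_log.
near=> x.
have gx : 0 < g x by near: x; exact: gH.1.
have x1 : 1 <= x by near: x; exact/nbhs_pinfty_ge/num_real.
have x0 : 0 < x by lra.
have D0 : 0 < (c - 1) * x + 1 by rewrite ltr_wpDl// mulr_ge0//; lra.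
have cx : x <= c * x by rewrite ler_peMl// ltW.
have cn := le_truncn cx.
have xn : (0 < Num.truncn x)%N by rewrite truncn_gt0.
have dn : (Num.truncn (c * x) - Num.truncn x)%:R <= (c - 1) * x + 1.
  have := truncnS_gt x; have := truncn_le (c * x); rewrite natrB// -natr1.
  rewrite (le_trans (ltW x0) cx); lra.
have -> : x / g x = (g x / x)^-1 by rewrite invf_div.
rewrite lee_pdivlMl ?divr_gt0//.
rewrite -(@lee_pmul2l _ ((c - 1) * x + 1)%:E) ?lte_fin//.
apply: (@le_trans _ _ ((Num.truncn (c * x) - Num.truncn x)%:R%:E *
    mean_inv Z 1 (Num.truncn x))%E); last first.
  by apply: lee_wpmul2r; rewrite ?mean_inv_ge0// lee_fin.
have xcn : (0 < Num.truncn x <= Num.truncn (c * x))%N by rewrite xn.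
apply: le_trans (mean_inv1_sum_ge Z_rev expectation_max_lty xcn).
rewrite -!EFinM lee_fin.
rewrite [leLHS](_ : _ = (kappa * H - e) * (g x / x) * ((c - 1) * x + 1)).
  by near: x.
by ring.
Unshelve. all: by end_near. Qed.

End mean_asymptotics.

Local Open Scope ereal_scope.

Theorem lemma5 (R : realType) (d : measure_display) (Omega : measurableType d)
    (P : probability Omega R) (Z : nat -> {RV P >-> R})
    (H kappa : R) (L : R -> R)
    (H_gt0 : (0 < H)%R) (H_lt1 : (H < 1)%R) (kappa_gt0 : (0 < kappa)%R)
    (L_sv : slowly_varying L)
    (cvg_sup : ((T `^ H * L T)^-1)%:E * 'E_P[running_sup Z T] @[T --> +oo%R]
               --> kappa%:E)
    (Z_rev : time_reversible Z) :
  limf_esup (fun x : R => (x `^ (1 - H) / L x)%:E *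
      'E_P[fun w => ((\sum_(0 <= l < (Num.truncn x).+1) expR (Z l w))^-1)%R])
    +oo%R <= (kappa * H)%:E
  /\
  (kappa * H)%:E <= limf_einf (fun x : R => (x `^ (1 - H) / L x)%:E *
      'E_P[fun w => ((\sum_(1 <= l < (Num.truncn x).+1) expR (Z l w))^-1)%R])
    +oo%R.
Proof.
have gH := slowly_varying_regular H L_sv.
have normE : \forall x \near +oo%R,
    (x `^ (1 - H) / L x = x / (x `^ H * L x))%R.
  near=> x.
  have x0 : (0 < x)%R by near: x; exact/nbhs_pinfty_gt/num_real.
  rewrite powRB; last by rewrite (gt_eqF x0) implybT.
  by rewrite powRr1 ?ltW// invfM mulrA.
split.
- apply: limf_esup_le => e e0; near=> x.
  rewrite (_ : (x `^ (1 - H) / L x = x / (x `^ H * L x))%R); last by near: x.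
  by near: x; exact: mean_inv0_eventually_le.
- apply: limf_einf_ge => e e0; near=> x.
  rewrite (_ : (x `^ (1 - H) / L x = x / (x `^ H * L x))%R); last by near: x.
  by near: x; exact: mean_inv1_eventually_ge.
Unshelve. all: by end_near. Qed.
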